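(* Let $\{G_n\}_{n\ge0}$ be a Gibonacci sequence and let $\{G'_n\}_{n\ge0}$ be the associated modified Gibonacci sequence. For all integers $n\geq 3$, $$G_n-G'_n=(G_1-G_0)f_{n-3}.$$
   Context: A Gibonacci sequence is a sequence satisfying $G_n=G_{n-1}+G_{n-2}$ for $n\ge2$, with initial values $G_0,G_1$ chosen freely (here arbitrary integers). The associated modified Gibonacci sequence is defined by $G'_0=G_1$, $G'_1=G_0$ and $G'_n=G'_{n-1}+G'_{n-2}$ for $n\ge 2$. The numbers $f_n$ are the shifted Fibonacci numbers $f_n=F_{n+1}$, where $F_0=0$, $F_1=1$, $F_n=F_{n-1}+F_{n-2}$ (so $f_0=f_1=1$, $f_2=2$). *)

(* Defs.v *)
From mathcomp Require Import all_boot all_order all_algebra.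

Set Implicit Arguments.
Unset Strict Implicit.
Unset Printing Implicit Defensive.

Import GRing.Theory.
Local Open Scope ring_scope.

Definition gibonacci (G : nat -> int) : Prop :=
  forall n : nat, (2 <= n)%N -> G n = G (n - 1)%N + G (n - 2)%N.

(* The initial values of G' are those of G, swapped; together with the
   recurrence they determine G' uniquely. *)
Definition modified_gibonacci (G G' : nat -> int) : Prop :=
  [/\ G' 0%N = G 1%N, G' 1%N = G 0%N & gibonacci G'].

Fixpoint fib (n : nat) : nat :=
  match n with
  | 0 => 0
  | n'.+1 => match n' with
             | 0 => 1
             | n''.+1 => fib n' + fib n''
             end
  end%N.

(* Shifted Fibonacci numbers: f_0 = f_1 = 1, f_2 = 2. *)
Definition shifted_fib (n : nat) : nat := fib n.+1.

(* Main.v *)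
Require Import Defs.
From mathcomp Require Import all_boot all_order all_algebra.
From mathcomp Require Import ring.

Import GRing.Theory.
Local Open Scope ring_scope.

(** The recurrence is linear, so [D = G - G'] is again a Gibonacci sequence.
    It starts with [D 0 = -d] and [D 1 = d], where [d = G 1 - G 0], hence
    [D 2 = 0] and [D 3 = d]: from index 2 on, [D] is [d] times the Fibonacci
    sequence. The shifted Fibonacci number of index [n - 3] is the Fibonacci
    number of index [n - 2], which gives the formula. *)

Lemma gibonacciSS (G : nat -> int) (m : nat) :
  gibonacci G -> G m.+2 = G m.+1 + G m.
Proof. by move=> /(_ m.+2 isT); rewrite subn1 subn2. Qed.

Lemma gibonacciB (G H : nat -> int) :
  gibonacci G -> gibonacci H -> gibonacci (fun n => G n - H n).
Proof. by move=> hG hH n n2; rewrite hG // hH //; ring. Qed.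

(** Opposite initial values cancel at index 2, so the sequence restarts there
    from [0] and [D 1], the initial values of [D 1] times Fibonacci. *)
Lemma gibonacci_opposite_fib (D : nat -> int) (m : nat) :
  gibonacci D -> D 0%N = - D 1%N -> D m.+2 = D 1%N * (fib m)%:Z.
Proof.
move=> hD D0.
have D2 : D 2%N = 0 by rewrite gibonacciSS // D0 subrr.
(* The recurrence has order two, so two consecutive indices are carried. *)
suff [] : D m.+2 = D 1%N * (fib m)%:Z /\ D m.+3 = D 1%N * (fib m.+1)%:Z by [].
elim: m => [|m [IH0 IH1]].
  by rewrite D2 gibonacciSS // D2 mulr0 mulr1 add0r.
split=> //; rewrite gibonacciSS // IH0 IH1.
by rewrite -[fib m.+2]/(fib m.+1 + fib m)%N PoszD mulrDr.
Qed.

Theorem mainTheorem7 (G G' : nat -> int) (hG : gibonacci G)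
    (hG' : modified_gibonacci G G') (n : nat) (hn : (3 <= n)%N) :
  G n - G' n = (G 1%N - G 0%N) * (shifted_fib (n - 3))%:Z.
Proof.
case: hG' => G'0 G'1 hG'.
case: n hn => [|[|[|k]]] // _.
rewrite -[k.+3]addn3 addnK addn3 /shifted_fib.
have D0 : G 0%N - G' 0%N = - (G 1%N - G' 1%N) by rewrite G'0 G'1 opprB.
by have := gibonacci_opposite_fib _ k.+1 (gibonacciB _ _ hG hG') D0; rewrite G'1.
Qed.
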